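(* (i) For every measurable space $(X,\mathcal{A})$, every capacity $\mu$ on $\mathcal{A}$, every $\mathcal{A}$-measurable function $f\colon X\to[0,1]$ and every sequence $(f_n)_{n=1}^\infty$ of $\mathcal{A}$-measurable functions $f_n\colon X\to[0,1]$: if $(f_n)$ converges strictly in $\mu$ to $f$, then $(f_n)$ converges in $\mu$ to $f$. (ii) The reverse implication is not true: there exist a measurable space $(X,\mathcal{A})$, a capacity $\mu$ on $\mathcal{A}$, and $\mathcal{A}$-measurable functions $f, f_n\colon X\to[0,1]$ ($n\ge 1$) such that $(f_n)$ converges in $\mu$ to $f$ but $(f_n)$ does not converge strictly in $\mu$ to $f$.
   Context: A measurable space $(X,\mathcal{A})$ consists of a non-empty set $X$ and a $\sigma$-algebra $\mathcal{A}$ of subsets of $X$. A capacity on $\mathcal{A}$ is a set function $\mu\colon\mathcal{A}\to[0,1]$ that is non-decreasing ($A\subseteq B$ implies $\mu(A)\le\mu(B)$) with $\mu(\emptyset)=0$ and $\mu(X)=1$; no additivity or continuity is assumed. For a function $g\colon X\to[0,1]$ write $\{g\ge t\}=\{x\in X: g(x)\ge t\}$ and $\{g>0\}=\{x\in X: g(x)>0\}$. Let $f,f_n\colon X\to[0,1]$ be $\mathcal{A}$-measurable. The sequence $(f_n)_{n=1}^\infty$ converges in $\mu$ to $f$ if $\lim_{n\to\infty}\mu(\{|f_n-f|\ge t\})=0$ for every $t\in(0,1]$. It converges strictly in $\mu$ to $f$ if $\lim_{n\to\infty}\mu(\{|f_n-f|>0\})=0$. *)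

(* Defs.v *)
From HB Require Import structures.
From mathcomp Require Import all_boot all_order all_algebra.
From mathcomp Require Import all_classical all_reals all_analysis.
Import Order.TTheory GRing.Theory Num.Theory.
Import numFieldNormedType.Exports.

Set Implicit Arguments.
Unset Strict Implicit.
Unset Printing Implicit Defensive.

Local Open Scope classical_set_scope.
Local Open Scope ring_scope.

(* Only the values of [capacity_fun] on measurable sets matter: a set function
   on the sigma-algebra is encoded as a total function whose values at
   non-measurable sets are unconstrained. Non-emptiness of the underlying set
   is built into [measurableType], which is pointed. *)
Record capacity (d : measure_display) (X : measurableType d) (R : realType) :=
  Capacity {
    capacity_fun :> set X -> R;
    capacity_range : forall A, measurable A -> 0 <= capacity_fun A <= 1;
    capacity_mono : forall A B, measurable A -> measurable B ->
      A `<=` B -> capacity_fun A <= capacity_fun B;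
    capacity_set0 : capacity_fun set0 = 0;
    capacity_setT : capacity_fun setT = 1
  }.

Definition unit_measurable_fun (d : measure_display) (X : measurableType d)
    (R : realType) (f : X -> R) : Prop :=
  measurable_fun setT f /\ forall x, 0 <= f x <= 1.

Definition cvg_in_capacity (d : measure_display) (X : measurableType d)
    (R : realType) (mu : capacity X R) (f_ : nat -> X -> R) (f : X -> R) : Prop :=
  forall t : R, 0 < t <= 1 ->
    (fun n => mu [set x | t <= `|f_ n x - f x|]) @ \oo --> (0 : R).

Definition cvg_strictly_in_capacity (d : measure_display) (X : measurableType d)
    (R : realType) (mu : capacity X R) (f_ : nat -> X -> R) (f : X -> R) : Prop :=
  (fun n => mu [set x | 0 < `|f_ n x - f x|]) @ \oo --> (0 : R).

(* Main.v *)
Require Import Defs.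
From mathcomp Require Import all_boot all_order all_algebra.
From mathcomp Require Import all_classical all_reals all_analysis measurable_realfun.
Import Order.TTheory GRing.Theory Num.Theory.
Import numFieldNormedType.Exports.

(** The implication holds because the set where [`|f_n - f| >= t] lies inside
    the set where [`|f_n - f| > 0] as soon as [t > 0]: monotonicity of the
    capacity then squeezes the former value between 0 and the latter
    ([cvg_strictly_cvg_in_capacity]). The only point needing care is that
    monotonicity is available on measurable sets, so that both level sets must
    be shown measurable.

    The converse fails already for a point mass and constants: the functions
    [harmonic n = 1 / (n + 1)] tend to 0 uniformly, so each set
    [`|f_n - 0| >= t] is eventually empty, but they never vanish, so the set
    [`|f_n - 0| > 0] is always the whole space, of capacity 1. *)

Set Implicit Arguments.
Unset Strict Implicit.
Unset Printing Implicit Defensive.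

Local Open Scope classical_set_scope.
Local Open Scope ring_scope.

Lemma measurable_fun_dist (d : measure_display) (X : measurableType d)
    (R : realType) (g f : X -> R) :
  measurable_fun setT g -> measurable_fun setT f ->
  measurable_fun setT (fun x => `|g x - f x|).
Proof.
by move=> mg mf; apply: measurableT_comp => //; exact: measurable_funB.
Qed.

Lemma measurable_dist_ge (d : measure_display) (X : measurableType d)
    (R : realType) (g f : X -> R) (t : R) :
  measurable_fun setT g -> measurable_fun setT f ->
  measurable [set x | t <= `|g x - f x|].
Proof.
move=> mg mf.
rewrite (_ : mkset _ = setT `&` (fun x => `|g x - f x|) @^-1` `[t, +oo[).
  by apply: measurable_fun_dist => //; exact: measurable_itv.
by rewrite setTI; apply/seteqP; split => x /=; rewrite in_itv /= andbT.
Qed.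

Lemma measurable_dist_gt (d : measure_display) (X : measurableType d)
    (R : realType) (g f : X -> R) (t : R) :
  measurable_fun setT g -> measurable_fun setT f ->
  measurable [set x | t < `|g x - f x|].
Proof.
move=> mg mf.
rewrite (_ : mkset _ = setT `&` (fun x => `|g x - f x|) @^-1` `]t, +oo[).
  by apply: measurable_fun_dist => //; exact: measurable_itv.
by rewrite setTI; apply/seteqP; split => x /=; rewrite in_itv /= andbT.
Qed.

(** Each level set [t <= `|f_ n - f|] with [t > 0] is contained in
    [0 < `|f_ n - f|], so monotonicity squeezes its capacity to 0. *)
Lemma cvg_strictly_cvg_in_capacity (d : measure_display) (X : measurableType d)
    (R : realType) (mu : capacity X R) (f_ : nat -> X -> R) (f : X -> R) :
  measurable_fun setT f -> (forall n, measurable_fun setT (f_ n)) ->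
  cvg_strictly_in_capacity mu f_ f -> cvg_in_capacity mu f_ f.
Proof.
move=> mf mf_ strict t /andP[t0 _].
apply: (@squeeze_cvgr _ _ _ _ (fun=> 0)
  (fun n => mu [set x | 0 < `|f_ n x - f x|])); [|exact: cvg_cst|exact: strict].
apply: nearW => n.
have mge := measurable_dist_ge t (mf_ n) mf.
have mgt := measurable_dist_gt 0 (mf_ n) mf.
have /andP[-> _] := capacity_range mu mge.
by apply: capacity_mono => // x /=; exact: lt_le_trans.
Qed.

(** The Dirac mass, on the one-point space, with values in [R] rather than in
    the extended reals. *)
Definition point_capacity_fun (R : realType) (A : set unit) : R := \1_A tt.

Lemma point_capacity_fun_range (R : realType) (A : set unit) :
  measurable A -> 0 <= point_capacity_fun R A <= 1.
Proof. by move=> _; rewrite /point_capacity_fun indicE ler0n lern1 leq_b1. Qed.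

Lemma point_capacity_fun_mono (R : realType) (A B : set unit) :
  measurable A -> measurable B -> A `<=` B ->
  point_capacity_fun R A <= point_capacity_fun R B.
Proof.
move=> _ _ AB; rewrite /point_capacity_fun !indicE ler_nat.
by case: (boolP (tt \in A)) => // /set_mem /AB /mem_set ->.
Qed.

Lemma point_capacity_fun0 (R : realType) : point_capacity_fun R set0 = 0.
Proof. by rewrite /point_capacity_fun indicE in_set0. Qed.

Lemma point_capacity_funT (R : realType) : point_capacity_fun R setT = 1.
Proof. by rewrite /point_capacity_fun indicE in_setT. Qed.

Definition point_capacity (R : realType) : capacity unit R :=
  Capacity (point_capacity_fun_range R) (point_capacity_fun_mono R)
    (point_capacity_fun0 R) (point_capacity_funT R).

(** Once [harmonic n < t], no point is at distance [t] or more from the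
    limit: the capacities are eventually equal to 0. *)
Lemma harmonic_cvg_in_point_capacity (R : realType) :
  cvg_in_capacity (point_capacity R) (fun n _ => harmonic n) (fun=> 0).
Proof.
move=> t /andP[t0 _].
have small : \forall n \near \oo, @harmonic R n < t.
  by apply: cvgr_lt t0; exact: cvg_harmonic.
apply: cvg_near_cst; near=> n.
have lt_t : @harmonic R n < t by near: n.
rewrite [X in point_capacity R X](_ : _ = set0) ?capacity_set0 //.
apply/seteqP; split => // x /=.
by rewrite subr0 ger0_norm ?harmonic_ge0 // leNgt lt_t.
Unshelve. all: by end_near. Qed.

(** [harmonic n] is positive for every [n], so the capacities form the constant
    sequence 1. *)
Lemma harmonic_not_cvg_strictly_in_point_capacity (R : realType) :
  ~ cvg_strictly_in_capacity (point_capacity R)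
      (fun n _ => harmonic n) (fun=> 0).
Proof.
rewrite /cvg_strictly_in_capacity.
rewrite (_ : (fun n => _) = (fun=> 1)); last first.
  apply/funext => n.
  rewrite [X in point_capacity R X](_ : _ = setT) ?capacity_setT //.
  apply/seteqP; split => // x _ /=.
  by rewrite subr0 ger0_norm ?harmonic_ge0 ?harmonic_gt0.
move=> /(cvg_lim (@Rhausdorff R)); rewrite (lim_cst (@Rhausdorff R)).
by move=> /(@eqP R); rewrite oner_eq0.
Qed.

Theorem theorem2p1 (R : realType) :
  (forall (d : measure_display) (X : measurableType d) (mu : capacity X R)
      (f : X -> R) (f_ : nat -> X -> R),
    unit_measurable_fun f ->
    (forall n : nat, unit_measurable_fun (f_ n)) ->
    cvg_strictly_in_capacity mu f_ f -> cvg_in_capacity mu f_ f)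
  /\
  (exists (d : measure_display) (X : measurableType d) (mu : capacity X R)
      (f : X -> R) (f_ : nat -> X -> R),
    unit_measurable_fun f /\
    (forall n : nat, unit_measurable_fun (f_ n)) /\
    cvg_in_capacity mu f_ f /\ ~ cvg_strictly_in_capacity mu f_ f).
Proof.
split=> [d X mu f f_ [mf _] mf_|].
  by apply: cvg_strictly_cvg_in_capacity => // n; have [] := mf_ n.
exists _, unit, (point_capacity R), (fun=> 0), (fun n _ => harmonic n).
split; first by split=> // x; rewrite lexx ler01.
split; last first.
  split; first exact: harmonic_cvg_in_point_capacity.
  exact: harmonic_not_cvg_strictly_in_point_capacity.
move=> n; split=> // x; rewrite harmonic_ge0 /=.
by rewrite invf_le1 ?ltr0n // ler1n.
Qed.
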